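(* Let $\delta\ge 1$. Every graph $G$ with $n$ vertices and minimum degree $\delta$ contains a spanning subgraph $H$ satisfying $m(H)\le 16\frac{n}{\delta}+4$.
   Context: All graphs are finite and simple. For a graph $G$ and an integer $k\ge 0$, $m(G,k)$ denotes the number of vertices of degree exactly $k$ in $G$, and $m(G)=\max_k m(G,k)$. A spanning subgraph of $G$ is a subgraph with the same vertex set as $G$. *)

(* Defs.v *)
From mathcomp Require Import all_boot all_order all_algebra.
Set Implicit Arguments. Unset Strict Implicit. Unset Printing Implicit Defensive.

Definition simple_graph (T : finType) (e : rel T) : Prop :=
  symmetric e /\ irreflexive e.

Definition deg (T : finType) (e : rel T) (x : T) : nat := #|[set y | e x y]|.

Definition mult_deg (T : finType) (e : rel T) (k : nat) : nat :=
  #|[set x | deg e x == k]|.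

(* m(G) = max_k m(G,k); degrees are < #|T|, so m(G,k) = 0 for k >= #|T| *)
Definition max_mult (T : finType) (e : rel T) : nat :=
  \max_(k < #|T|.+1) mult_deg e k.

Definition min_degree_is (T : finType) (e : rel T) (d : nat) : Prop :=
  (exists x : T, deg e x = d) /\ (forall x : T, d <= deg e x).

Definition spanning_subgraph (T : finType) (e h : rel T) : Prop :=
  simple_graph h /\ subrel h e.

(* Main.v *)
(** Following Addario-Berry, Dalal and Reed, suppose every vertex v is given
    a_v + 2 <= b_v with a_v and b_v suitably close to deg(v)/2.  Then some
    spanning subgraph h has all its degrees in {a_v, a_v+1, b_v, b_v+1}.  Start
    from h = e and, while some v is bad (degree outside its set), look at the
    alternating paths from v which leave v along an edge of h and alternate
    between non-low vertices and low ones (degree a or b).  Either flipping such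
    a path, followed by toggling a few edges at its end, lowers the total degree
    of the bad vertices, or counting the edges of h and of e \ h between the
    non-low and the low vertices reached gives contradictory inequalities.

    Now put C = floor((delta+4)/8), split the vertices evenly into C classes, and
    for v of class c take a_v = 2c (mod 2C) just below deg(v)/2, b_v = a_v + 2C.
    A degree then determines the class of its vertex, so it occurs at most
    n/C + 1 <= 16n/delta + 1 times. *)
Require Import Defs.
From mathcomp Require Import all_boot all_order all_algebra zify.
Import GRing.Theory Num.Theory.

Set Implicit Arguments.
Unset Strict Implicit.
Unset Printing Implicit Defensive.

(** * Toggling a star of edges at one vertex *)

Lemma deg_sum (T : finType) (h : rel T) (u : T) : deg h u = \sum_w h u w.
Proof.
by rewrite /deg -sum1_card big_mkcond /=; apply: eq_bigr => w _; rewrite inE; case: (h u w).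
Qed.

Definition star_flip {T : finType} (h : rel T) (z : T) (N : {set T}) : rel T :=
  fun u w => h u w (+) ((u == z) && (w \in N) || (w == z) && (u \in N)).

Lemma star_flip_sym {T : finType} (h : rel T) z N :
  symmetric h -> symmetric (star_flip h z N).
Proof. by move=> hs u w; rewrite /star_flip hs orbC. Qed.

Lemma star_flip_sub {T : finType} (e h : rel T) z (N : {set T}) :
  symmetric e -> subrel h e -> (forall w, w \in N -> e z w) ->
  subrel (star_flip h z N) e.
Proof.
move=> es he Ne u w; rewrite /star_flip.
case huw: (h u w) => /=; first by move=> _; apply: he.
by case/orP=> /andP[/eqP-> /Ne] //; rewrite es.
Qed.

Lemma deg_star_add (T : finType) (h : rel T) (z : T) (N : {set T}) (u : T) :
  symmetric h -> z \notin N -> (forall w, w \in N -> ~~ h z w) ->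
  deg (star_flip h z N) u = deg h u + (u == z) * #|N| + (u \in N).
Proof.
move=> hs zN hN; rewrite !deg_sum.
have [->|uz] := eqVneq u z.
  rewrite (negPf zN) addn0 mul1n -sum1_card [X in _ + X]big_mkcond -big_split.
  apply: eq_bigr => w _; rewrite /star_flip eqxx (negPf zN) andbF orbF /=.
  by case: ifP => [/hN/negPf->|] //=; rewrite addbF addn0.
rewrite mul0n addn0; have [uN|uN] := boolP (u \in N); last first.
  by rewrite addn0; apply: eq_bigr => w _; rewrite /star_flip (negPf uz) (negPf uN) andbF addbF.
rewrite (bigD1 z) //= [in RHS](bigD1 z) //= /star_flip (negPf uz) eqxx uN /=.
rewrite (_ : h u z = false) ?add0n; last by rewrite hs; apply/negbTE/hN.
rewrite addnC; congr (_ + _); apply: eq_bigr => w /negPf wz.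
by rewrite wz addbF.
Qed.

Lemma star_flipK {T : finType} (h : rel T) z N : star_flip (star_flip h z N) z N =2 h.
Proof. by move=> u w; rewrite /star_flip -addbA addbb addbF. Qed.

Lemma eq_deg (T : finType) (h g : rel T) u : h =2 g -> deg h u = deg g u.
Proof. by move=> hg; rewrite !deg_sum; apply: eq_bigr => w _; rewrite hg. Qed.

(** A star flip is an involution, so this is [deg_star_add] read from the flipped graph. *)
Lemma deg_star_del (T : finType) (h : rel T) (z : T) (N : {set T}) (u : T) :
  symmetric h -> z \notin N -> (forall w, w \in N -> h z w) ->
  deg (star_flip h z N) u + (u == z) * #|N| + (u \in N) = deg h u.
Proof.
move=> hs zN hN; rewrite -(eq_deg _ (star_flipK h z N)).
rewrite (deg_star_add _ (star_flip_sym _ _ hs) zN) //.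
by move=> w wN; rewrite /star_flip hN // eqxx wN.
Qed.

Lemma subset_of_card (T : finType) (A : {set T}) k : k <= #|A| ->
  exists2 B : {set T}, B \subset A & #|B| = k.
Proof.
case/card_geqP=> s [us <- sA]; exists [set x in s].
  by apply/subsetP => x; rewrite inE; apply: sA.
by rewrite cardsE; apply/card_uniqP.
Qed.

(** * Alternating paths and their flips *)

Section DegreeConstrained.
Context {T : finType} (e : rel T) (a b : T -> nat).
Hypothesis e_sym : symmetric e.
Hypothesis e_irr : irreflexive e.

Definition low (h : rel T) u := (deg h u == a u) || (deg h u == b u).
Definition good u d := d \in [:: a u; (a u).+1; b u; (b u).+1].
(** Charging a bad vertex its whole degree makes each lost edge count as progress, even when the
    vertex stays bad. *)
Definition cost u d := if good u d then 0 else d.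
Definition valid (h : rel T) :=
  [/\ symmetric h, subrel h e & forall u, a u <= deg h u].
(* A vertex entered by an arc of [alt] and left by another one keeps its degree
   when both edges are flipped. *)
Definition alt (h : rel T) : rel T := fun u w =>
  if low h u then [&& e u w, ~~ h u w & ~~ low h w] else h u w && low h w.

(* The last edge of the path is the only edge at its endpoint that is flipped;
   [q] is the vertex preceding the endpoint. *)
Lemma alt_path_flip h v p : symmetric h -> subrel h e ->
  path (alt h) v p -> uniq (v :: p) -> ~~ low h v ->
  exists g q, let z := last v p in
  [/\ symmetric g, subrel g e,
   forall u, deg g u + (u == v) + (u == z) * low h z = deg h u + (u == z) * ~~ low h z,
   (forall u w, u \notin v :: p -> g u w = h u w) /\
   (forall w, w != q -> g z w = h z w)
   & q = z \/ low h q = ~~ low h z].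
Proof.
move=> hs he; elim/last_ind: p => [|p z IH].
  (* On the empty path the loss at [v] and the gain at the non-low endpoint cancel. *)
  move=> _ _ vl /=; exists h, v; split=> //; last by left.
  by move=> u; rewrite (negPf vl) muln0 muln1 addn0.
rewrite rcons_path -rcons_cons rcons_uniq.
move=> /andP[hp hz] /andP[zp up] vl.
have [g [_ [gs ge gd [go _] _]]] := IH hp up vl.
move: hz gd; rewrite last_rcons; set y := last v p => hz gd.
have yp : y \in v :: p by exact: mem_last.
have zy : z != y by apply: contraNneq zp => ->.
have vz : v == z = false by apply: contraNF zp => /eqP <-; rewrite mem_head.
have gyz : g y z = h y z by rewrite gs go // hs.
have hyz : low h z = ~~ low h y /\ h y z = ~~ low h y /\ e y z.
  move: hz; rewrite /alt; case: (low h y) => [/and3P[-> /negPf-> /negPf->]|/andP[hyz ->]] //.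
  by rewrite hyz he.
case: hyz => lz [hyz eyz].
(* Toggling [y z] cancels the surplus or deficit recorded at [y] and passes the opposite one to
   [z]. *)
exists (star_flip g y [set z]), y; split.
- exact: star_flip_sym.
- by apply: star_flip_sub => // w /set1P->.
- move=> u; have := gd u.
  have yN : y \notin [set z] by rewrite inE eq_sym.
  rewrite lz; have [ly|ly] := boolP (low h y); rewrite /= ?muln0 ?muln1 ?addn0.
    rewrite deg_star_add //; last by move=> w /set1P->; rewrite gyz hyz ly.
    by rewrite cards1 inE; clear; lia.
  have := deg_star_del u gs yN.
  rewrite cards1 inE => <-; first by clear; lia.
  by move=> w /set1P->; rewrite gyz hyz ly.
- split.
    move=> u w; rewrite mem_rcons inE => /norP[uz up'].
    have uy : u == y = false by apply: contraNF up' => /eqP->.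
    by rewrite /star_flip go // !inE (negPf uz) uy andbF addbF.
  move=> w wy; rewrite /star_flip (negPf zy) (negPf wy) /= addbF.
  by apply: go.
- by right; rewrite lz negbK.
Qed.

(** * The potential and the degree changes it tolerates *)

Hypothesis ab_gap : forall u, a u + 2 <= b u.

Definition Phi (h : rel T) := \sum_u cost u (deg h u).
Definition improvable h := exists2 g, valid g & Phi g < Phi h.

Lemma improvableI h g v : symmetric g -> subrel g e ->
  (forall u, a u <= deg g u /\ (good u (deg g u) \/ ~~ good u (deg h u) /\ deg g u <= deg h u)) ->
  ~~ good v (deg h v) -> 0 < deg h v -> good v (deg g v) \/ deg g v < deg h v ->
  improvable h.
Proof.
move=> gs ge hu vb v0 vg; exists g; first by split=> // u; case: (hu u).
rewrite /Phi (bigD1 v) //= [ltnRHS](bigD1 v) //= -addSn leq_add //.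
  by rewrite /cost (negPf vb); case: ifP vg => // _ [].
apply: leq_sum => u _; rewrite /cost.
by case: (hu u) => _ [->|[/negPf-> ug]] //; case: ifP.
Qed.

Lemma bad_nonlow h v : ~~ good v (deg h v) -> ~~ low h v.
Proof. by rewrite /good /low !inE; lia. Qed.

(** Here [i] marks the start of the path and [j] the far end of a deleted edge. A good non-low
    vertex has degree [a + 1] or [b + 1] and can lose one edge; a bad one has degree at least
    [a + 2] and can lose two. *)
Lemma step_down u d d' (i j : bool) : d' + i + j = d -> a u <= d ->
  (i -> ~~ good u d) -> (j -> (d != a u) && (d != b u)) ->
  a u <= d' /\ (good u d' \/ ~~ good u d /\ d' <= d).
Proof.
move: (ab_gap u) => ab <-; rewrite /good !inE.
by case: i => [] /= ad /(_ _) H1; case: j ad H1 => [] /= ad H1 /(_ _) H2; lia.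
Qed.

(** A low vertex stays good after gaining one edge; being good, it is never the start of the
    path. *)
Lemma step_up u d d' (i j : bool) : d' + i = d + j -> a u <= d ->
  (i -> ~~ good u d) -> (j -> (d == a u) || (d == b u)) ->
  a u <= d' /\ (good u d' \/ ~~ good u d /\ d' <= d).
Proof.
move: (ab_gap u) => ab; rewrite /good !inE.
by case: i => [] /= E ad /(_ _) H1; case: j E H1 => [] /= ad' H1 /(_ _) H2; lia.
Qed.

(** * Four local improvements at the end of an alternating path *)

Section Improve.
Context (h : rel T) (v z : T).
Hypothesis h_ok : valid h.
Hypothesis v_bad : ~~ good v (deg h v).
Lemma bad_gt0 : 0 < deg h v.
Proof.
by move: v_bad; case: h_ok => _ _ /(_ v); rewrite /good !inE; case: (deg h v) (a v) => [|n] [].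
Qed.

Hypothesis vz : connect (alt h) v z.

Lemma alt_connect_flip : exists g q,
  [/\ symmetric g, subrel g e,
   forall u, deg g u + (u == v) + (u == z) * low h z = deg h u + (u == z) * ~~ low h z,
   (forall w, w != q -> g z w = h z w)
   & q = z \/ low h q = ~~ low h z].
Proof.
case: h_ok => hs he _; case/connectP: vz => p /shortenP[p' hp up _] ->.
case: (alt_path_flip hs he hp up (bad_nonlow v_bad)) => g [q [? ? ? [_ ?] ?]].
by exists g, q.
Qed.

(** Deleting [z w] takes back the edge that the path gave to [z], so only [v] and [w] lose edges;
    they may coincide. *)
Lemma improve_del1 w : ~~ low h z -> ~~ low h w -> h z w -> improvable h.
Proof.
move=> zl wl hzw; case: h_ok => hs he ha.
have zw : z != w by apply: contraTneq hzw => ->; apply/negP => /he; rewrite e_irr.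
have [g [q [gs ge gd gq qP]]] := alt_connect_flip.
(* At [z] the path flips only the edge to [q], which is low while [w] is not. *)
have gzw : g z w.
  rewrite gq //; apply/eqP => wq; move: hzw wl; rewrite wq.
  by case: qP => [->|->]; [move=> /he; rewrite e_irr | rewrite zl].
have zN : z \notin [set w] by rewrite inE.
have E u : deg (star_flip g z [set w]) u + (u == v) + (u == w) = deg h u.
  move: (gd u); rewrite -(deg_star_del u gs zN) ?cards1 ?inE; last by move=> x /set1P->.
  by rewrite (negPf zl); clear; lia.
apply: (@improvableI h (star_flip g z [set w]) v) => //.
- exact: star_flip_sym.
- by apply: star_flip_sub => // x /set1P->; apply: ge.
- move=> u; apply: (step_down (E u)) => // [/eqP->|/eqP->] //.
  by rewrite -negb_or.
- exact: bad_gt0.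
- by right; rewrite -(E v) eqxx; clear; lia.
Qed.

(** Dual to [improve_del1]: the new edge [z w] repairs the loss at the low endpoint [z]. *)
Lemma improve_add1 w : low h z -> low h w -> e z w -> ~~ h z w -> improvable h.
Proof.
move=> zl wl ezw hzw; case: h_ok => hs he ha.
have zw : z != w by apply: contraTneq ezw => ->; rewrite e_irr.
have [g [q [gs ge gd gq qP]]] := alt_connect_flip.
have gzw : ~~ g z w.
  rewrite gq //; apply/eqP => wq; move: ezw wl; rewrite wq.
  by case: qP => [->|->]; [rewrite e_irr | rewrite zl].
have zN : z \notin [set w] by rewrite inE.
have E u : deg (star_flip g z [set w]) u + (u == v) = deg h u + (u == w).
  move: (gd u); rewrite deg_star_add ?cards1 ?inE //; last by move=> x /set1P->.
  by rewrite zl; clear; lia.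
apply: (@improvableI h (star_flip g z [set w]) v) => //.
- exact: star_flip_sym.
- by apply: star_flip_sub => // x /set1P->.
- by move=> u; apply: (step_up (E u)) => // [/eqP->|/eqP->] //.
- exact: bad_gt0.
- right; move: (E v); rewrite eqxx (_ : v == w = false); first by clear; lia.
  by apply: contraNF (bad_nonlow v_bad) => /eqP->.
Qed.

(* The endpoint jumps to degree [b z] at the expense of low neighbours, each of
   which can afford one more edge. *)
Lemma improve_jump_up : ~~ low h z -> deg h z < b z ->
  let N := [set w | [&& low h w, e z w & ~~ h z w]] in
  (if good z (deg h z) then b z <= deg h z + #|N| else b z < deg h z + #|N|) ->
  improvable h.
Proof.
move=> zl zb N Nbig; case: h_ok => hs he ha.
have [g [q [gs ge gd gq qP]]] := alt_connect_flip.
(* The path may already use the neighbour [q]. A good [z] differs from [v], so the path has given it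
   an edge, which makes up for [q]; a bad [z] may be [v] itself, hence the strict bound. *)
have [M MN cM] : exists2 M : {set T}, M \subset N :\ q & #|M| = b z - deg g z.
  apply: subset_of_card; move: (cardsD1 q N) (gd z) Nbig.
  rewrite (negPf zl) eqxx.
  have: good z (deg h z) -> z == v = false.
    by move=> gz; apply: contraNF v_bad => /eqP <-.
  by case: ifP => _ => [/(_ isT)->|_]; case: (q \in N); clear; lia.
have MP w : w \in M -> [/\ low h w, e z w & ~~ g z w].
  move/(subsetP MN); rewrite !inE => /andP[wq /and3P[lw ew hw]].
  by rewrite gq.
have zM : z \notin M by apply/negP => /MP[]; rewrite (negPf zl).
have E u : deg (star_flip g z M) u + (u == v) = deg h u + (u == z) * (#|M|.+1) + (u \in M).
  move: (gd u); rewrite deg_star_add //; last by move=> x /MP[].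
  by rewrite (negPf zl); clear; case: (u == z); lia.
have Ez : deg (star_flip g z M) z = b z.
  move: (E z) (gd z); rewrite (negPf zM) eqxx (negPf zl) cM.
  by move: zb; clear; lia.
have bz : good z (b z) by rewrite /good !inE eqxx !orbT.
apply: (@improvableI h (star_flip g z M) v) => //.
- exact: star_flip_sym.
- by apply: star_flip_sub => // x /MP[].
- move=> u; have [->|uz] := eqVneq u z.
    by rewrite Ez; split; [move: (ab_gap z); lia | left].
  apply: (@step_up u (deg h u) _ (u == v) (u \in M)) => // [|/eqP->|/MP[]] //.
  by rewrite E (negPf uz) addn0.
- exact: bad_gt0.
- have [->|vz'] := eqVneq v z; first by left; rewrite Ez.
  right; move: (E v); rewrite eqxx (negPf vz') (_ : v \in M = false); first by clear; lia.
  by apply: contraNF (bad_nonlow v_bad) => /MP[].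
Qed.

(** The endpoint drops from [b z] to [a z + 1] at the expense of non-low neighbours, each of which
    can spare an edge. *)
Lemma improve_jump_down : deg h z = b z ->
  let N := [set w | ~~ low h w && h z w] in
  b z < a z + 2 + #|N| -> improvable h.
Proof.
move=> zb N Nbig; case: h_ok => hs he ha.
have zl : low h z by rewrite /low zb eqxx orbT.
have zv : z == v = false by apply: contraNF (bad_nonlow v_bad) => /eqP <-.
have [g [q [gs ge gd gq qP]]] := alt_connect_flip.
have gz : deg g z = (b z).-1.
  by move: (gd z); rewrite zv zl eqxx zb; clear; lia.
(* The path has removed one edge at [z], so [b z - 1 - (a z + 1)] more must go; the bound on [N]
   leaves one spare for [q]. *)
have [M MN cM] : exists2 M : {set T}, M \subset N :\ q & #|M| = b z - (a z + 2).
  apply: subset_of_card; move: (cardsD1 q N) Nbig (ab_gap z).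
  by case: (q \in N); clear; lia.
have MP w : w \in M -> [/\ ~~ low h w, e z w & g z w].
  move/(subsetP MN); rewrite !inE => /andP[wq /andP[lw hw]].
  by rewrite gq // he.
have zM : z \notin M by apply/negP => /MP[]; rewrite zl.
have E u : deg (star_flip g z M) u + (u == v) + (u \in M) + (u == z) * (#|M|.+1) = deg h u.
  move: (gd u); rewrite -(deg_star_del u gs zM); last by move=> x /MP[].
  by rewrite zl; clear; case: (u == z); lia.
have Ez : deg (star_flip g z M) z = (a z).+1.
  move: (E z); rewrite (negPf zM) eqxx zv zb cM.
  by move: (ab_gap z); clear; lia.
apply: (@improvableI h (star_flip g z M) v) => //.
- exact: star_flip_sym.
- by apply: star_flip_sub => // x /MP[].
- move=> u; have [->|uz] := eqVneq u z.
    by rewrite Ez; split; [lia | left; rewrite /good !inE eqxx orbT].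
  apply: (@step_down u (deg h u) _ (u == v) (u \in M)) => // [|/eqP->|/MP[]] //.
    by rewrite -[RHS]E (negPf uz) addn0.
  by rewrite -negb_or.
- exact: bad_gt0.
- right; move: (E v); rewrite eqxx; clear; lia.
Qed.
End Improve.

(** * Double counting when no improvement applies, and descent *)

Hypothesis a_half : forall u, 2 * a u <= deg e u.
Hypothesis b_half : forall u, deg e u <= 2 * b u + 2.
Hypothesis b_le_2a : forall u, b u <= 2 * a u + 3.
Hypothesis b_le_mid : forall u, 2 * b u <= deg e u + a u + 2.

Lemma deg_compl h u : subrel h e -> deg h u + \sum_w (e u w && ~~ h u w) = deg e u.
Proof.
move=> he; rewrite !deg_sum -big_split; apply: eq_bigr => w _ /=.
by case huw: (h u w) => /=; rewrite ?(he _ _ huw) // andbT.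
Qed.

Lemma bad_improvable h v : valid h -> ~~ good v (deg h v) -> improvable h.
Proof.
move=> h_ok vb; case: (h_ok) => hs he ha.
pose R := connect (alt h) v.
have [/existsP[z /existsP[w /and4P[Rz zl wl hzw]]]|no1] :=
  boolP [exists z, exists w, [&& R z, ~~ low h z, ~~ low h w & h z w]].
  exact: (improve_del1 h_ok vb Rz zl wl).
have [/existsP[z /existsP[w /and5P[Rz zl wl ezw hzw]]]|no2] :=
  boolP [exists z, exists w, [&& R z, low h z, low h w, e z w & ~~ h z w]].
  exact: (improve_add1 h_ok vb Rz zl wl).
pose n z := #|[set w | [&& low h w, e z w & ~~ h z w]]|.
have [/existsP[z /and4P[Rz zl zb nz]]|no3] := boolP [exists z, [&& R z, ~~ low h z,
    deg h z < b z & if good z (deg h z) then b z <= deg h z + n z else b z < deg h z + n z]].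
  exact: (improve_jump_up h_ok vb Rz).
pose m z := #|[set w | ~~ low h w && h z w]|.
have [/existsP[z /and3P[Rz /eqP zb mz]]|no4] :=
    boolP [exists z, [&& R z, deg h z == b z & b z < a z + 2 + m z]].
  exact: (improve_jump_down h_ok vb Rz).
have mE z : m z = \sum_w (~~ low h w && h z w).
  by rewrite /m -sum1_card big_mkcond; apply: eq_bigr => w _; rewrite inE; case: ifP.
have nE z : n z = \sum_w [&& low h w, e z w & ~~ h z w].
  by rewrite /n -sum1_card big_mkcond; apply: eq_bigr => w _; rewrite inE; case: ifP.
have m_deg z : m z <= deg h z.
  by rewrite mE deg_sum leq_sum // => w _; case: (low h w).
have n_deg z : deg h z + n z <= deg e z.
  by rewrite -(deg_compl z he) leq_add2l nE leq_sum // => w _; case: (low h w).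
(* By [no1], every edge of [h] at a reached non-low vertex leads to a low vertex, which is then
   reached too. *)
have degs : \sum_(z | R z && ~~ low h z) deg h z <= \sum_(z | R z && low h z) m z.
  under eq_bigr do rewrite deg_sum.
  under [leqRHS]eq_bigr do rewrite mE.
  under eq_bigr => z /andP[Rz zl].
    rewrite (_ : \sum_w h z w = \sum_(w | R w && low h w) h z w); last first.
      rewrite [RHS]big_mkcond; apply: eq_bigr => w _; case hzw: (h z w); last by case: ifP.
      have wl : low h w.
        move/existsPn/(_ z)/existsPn/(_ w): no1.
        by rewrite Rz zl hzw andbT negbK.
      rewrite wl andbT (_ : R w) //; apply: connect_trans Rz _; apply: connect1.
      by rewrite /alt (negPf zl) hzw.
    over.
  rewrite exchange_big /=; apply: leq_sum => w _; rewrite big_mkcond.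
  by apply: leq_sum => z _; rewrite hs; case: (R z) (low h z) => [] [].
(* Dually, by [no2], for the edges of [e] outside [h] at reached low vertices. *)
have codegs : \sum_(z | R z && low h z) (deg e z - deg h z) <= \sum_(z | R z && ~~ low h z) n z.
  under eq_bigr => z /andP[Rz zl].
    rewrite -{1}(deg_compl z he) addKn.
    rewrite (_ : \sum_w _ = \sum_(w | R w && ~~ low h w) (e z w && ~~ h z w)); last first.
      rewrite [RHS]big_mkcond; apply: eq_bigr => w _.
      case ezw: (e z w && ~~ h z w); last by case: ifP.
      have wl : ~~ low h w.
        apply/negP => wl; move/existsPn/(_ z)/existsPn/(_ w): no2.
        by rewrite Rz zl wl ezw.
      rewrite wl andbT (_ : R w) //; apply: connect_trans Rz _; apply: connect1.
      by rewrite /alt zl wl andbT.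
    over.
  under [leqRHS]eq_bigr do rewrite nE.
  rewrite exchange_big /=; apply: leq_sum => w _; rewrite big_mkcond.
  by apply: leq_sum => z _; rewrite e_sym hs; case: (R z) (low h z) => [] [].
(* At degree [a z] this follows from [a_half]; at degree [b z], from [no4] and [b_le_mid]. *)
have mP z : R z && low h z -> m z <= deg e z - deg h z.
  case/andP=> Rz zl; move/existsPn/(_ z): no4; rewrite Rz.
  move: zl (a_half z) (b_le_mid z) (m_deg z) (ab_gap z); rewrite /low.
  by clear; lia.
(* Above [b z] the bound comes from [b_half], since few edges of [e] remain; below [b z], from [no3]
   and [b_le_2a]. The extra unit at bad vertices makes the final sum strict at [v]. *)
have nP z : R z && ~~ low h z -> n z + ~~ good z (deg h z) <= deg h z.
  case/andP=> Rz zl; move/existsPn/(_ z): no3; rewrite Rz zl.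
  move: zl (b_half z) (b_le_2a z) (n_deg z) (ab_gap z) (ha z); rewrite /low /good !inE.
  by case: ifP; clear; lia.
have Xv : R v && ~~ low h v by rewrite /R connect0 bad_nonlow.
have: \sum_(z | R z && ~~ low h z) n z < \sum_(z | R z && ~~ low h z) deg h z.
  rewrite (bigD1 v) //= [ltnRHS](bigD1 v) //= -addSn leq_add //.
    by have := nP v Xv; rewrite vb addn1.
  by apply: leq_sum => z /andP[/nP + _]; apply: leq_trans; apply: leq_addr.
by rewrite ltnNge (leq_trans degs) // (leq_trans _ codegs) // leq_sum.
Qed.

Lemma degree_constrained_subgraph :
  exists h : rel T, [/\ symmetric h, subrel h e & forall u, good u (deg h u)].
Proof.
have ev : valid e by split=> // u; have := a_half u; lia.
suff descent k h : Phi h < k -> valid h ->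
    exists h' : rel T, [/\ symmetric h', subrel h' e & forall u, good u (deg h' u)].
  exact: (descent _ e (ltnSn _) ev).
elim: k h => // k IH h hk hv.
have [/forallP hg|/forallPn[v vb]] := boolP [forall u, good u (deg h u)].
  by case: hv => hs he _; exists h.
have [g gv gh] := bad_improvable hv vb.
by apply: (IH g) => //; apply: leq_trans gh _.
Qed.
End DegreeConstrained.

(** * Residue classes of degrees and the choice of constants *)

(** Within a class the rank is determined by its quotient by [C], which is at most [#|T| %/ C]. *)
Lemma card_rank_mod (T : finType) C c :
  #|[set x : T | enum_rank x %% C == c]| <= (#|T| %/ C).+1.
Proof.
pose f (x : T) : 'I_(#|T| %/ C).+1 := inord (enum_rank x %/ C).
rewrite -[leqRHS]card_ord; apply: (@leq_card_in _ _ f) => x y.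
rewrite !inE => /eqP xc /eqP yc /(congr1 val).
have fE (z : T) : f z = enum_rank z %/ C :> nat by rewrite inordK // ltnS leq_div2r // ltnW.
rewrite /= !fE => xy; apply/enum_rank_inj/val_inj => /=.
by rewrite (divn_eq (enum_rank x) C) (divn_eq (enum_rank y) C) xy xc yc.
Qed.

Lemma residue_below s C c : c < C -> 2 * C <= s.+1 -> exists a,
  [/\ a <= s, s < a + 2 * C & exists q, a = 2 * c + q * (2 * C)].
Proof.
(* Subtracting from [s] the residue of [s - 2c] modulo [M] gives a number congruent to [2c]; the
   period added in [t] is undone by [q.-1]. *)
move=> cC sC; set M := 2 * C; set t := s + M - 2 * c.
have := divn_eq t M; have : t %% M < M by rewrite ltn_mod; lia.
set q := t %/ M; set r := t %% M => rM tE.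
exists (s - r); split; [lia | lia | exists q.-1].
case: q tE => [|q]; rewrite /t ?mulSn /M /=; first by lia.
by lia.
Qed.

Theorem theorem1p6 (T : finType) (e : rel T) (delta : nat) :
  simple_graph e -> (1 <= delta)%N -> min_degree_is e delta ->
  exists h : rel T, spanning_subgraph e h /\
    ((max_mult h)%:R <= 16%:R * (#|T|%:R / delta%:R) + 4%:R :> rat)%R.
Proof.
move=> [es ei] d1 [_ dmin].
suff [h [hs he hm]] : exists h : rel T,
    [/\ symmetric h, subrel h e & delta * max_mult h <= 16 * #|T| + 4 * delta].
  exists h; split; first by split=> //; split=> // x; apply/negP => /he; rewrite ei.
  rewrite mulrA -[X in (_ + X)%R](mulfK (_ : delta%:R != 0 :> rat)%R); last by rewrite pnatr_eq0 -lt0n.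
  by rewrite -mulrDl ler_pdivlMr ?ltr0n // -!natrM -natrD ler_nat mulnC.
(* For [delta] at most 16 the bound exceeds the number of vertices, so [e] itself serves. *)
have [d16|d16] := leqP delta 16.
  exists e; split=> //; apply: (@leq_trans (16 * #|T|)); last exact: leq_addr.
  by apply: leq_mul => //; apply/bigmax_leqP => k _; apply: max_card.
(* The inequality [8 * C <= delta + 4] is just what [b_le_mid] needs when [a x] is half the degree;
   the final count needs [delta <= 16 * C]. *)
pose C := (delta + 4) %/ 8; pose c (x : T) := enum_rank x %% C.
have C_gt0 : 0 < C by rewrite /C; lia.
have C_delta : 8 * C <= delta + 4 by rewrite /C; lia.
have cC x : c x < C by rewrite ltn_mod.
have a_ex x : exists a, [/\ a <= (deg e x)./2, (deg e x)./2 < a + 2 * C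
    & exists q, a = 2 * c x + q * (2 * C)].
  by apply: residue_below => //; move: (dmin x); lia.
have [a aP] := fin_all_exists a_ex; pose b x := a x + 2 * C.
have [|||||h [hs he hg]] := @degree_constrained_subgraph T e a b es ei.
- by move=> x; rewrite /b; lia.
- by move=> x; case: (aP x); lia.
- by move=> x; case: (aP x); rewrite /b; lia.
- by move=> x; case: (aP x); move: (dmin x); rewrite /b; lia.
- by move=> x; case: (aP x); move: (dmin x); rewrite /b; lia.
exists h; split=> //.
(* As [b x] and [a x] agree modulo [2 * C], all four allowed degrees have residue [2c] or [2c + 1],
   and [c < C] prevents wrapping. *)
have class x : c x = (deg h x %% (2 * C))./2.
  case: (aP x) => _ _ [q aq].
  have [q' [i [i1 ->]]] : exists q' i, i <= 1 /\ deg h x = q' * (2 * C) + (2 * c x + i).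
    move: (hg x); rewrite /good /b !inE => /or4P[] /eqP->.
    - by exists q, 0; lia.
    - by exists q, 1; lia.
    - by exists q.+1, 0; lia.
    - by exists q.+1, 1; lia.
  by rewrite modnMDl modn_small; move: (cC x); lia.
have mh : max_mult h <= (#|T| %/ C).+1.
  apply/bigmax_leqP => k _; apply: leq_trans (card_rank_mod T C (k %% (2 * C))./2).
  apply: subset_leq_card; apply/subsetP => x; rewrite !inE => /eqP <-.
  by rewrite -class.
have dC : delta <= 16 * C by rewrite /C; lia.
have TC : #|T| %/ C * C <= #|T| by apply: leq_trunc_div.
by nia.
Qed.
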